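(* Let $X$ and $Y$ be two independent non-negative random variables, let $n$ be a positive integer, and let $\alpha>0$, $\alpha\neq1$. If $X$ and $Y$ have log-concave densities, then $$S_{\alpha}(\boldsymbol X_{\rm MRSSU}+\boldsymbol Y_{\rm MRSSU})\geq \max\{ S_{\alpha}(\boldsymbol X_{\rm MRSSU}),\,S_{\alpha}(\boldsymbol Y_{\rm MRSSU})\}.$$
   Context: $X$ and $Y$ are non-negative, absolutely continuous random variables. $\boldsymbol X_{\rm MRSSU}$ (maximum ranked set sampling with unequal samples, size $n$) is a vector of $n$ independent random variables whose $i$-th component $X_{(i:i)}$ is the maximum of a simple random sample of size $i$ from $X$ (pdf $i f(x)[F(x)]^{i-1}$ if $X$ has pdf $f$ and cdf $F$); $\boldsymbol Y_{\rm MRSSU}$ is defined likewise from $Y$, independently of $\boldsymbol X_{\rm MRSSU}$. $\boldsymbol X_{\rm MRSSU}+\boldsymbol Y_{\rm MRSSU}$ is the componentwise sum, with independent components $X_{(i:i)}+Y_{(i:i)}$. For a vector $\boldsymbol V=(V_1,\dots,V_n)$ of independent non-negative random variables with pdfs $h_1,\dots,h_n$, the Tsallis entropy of order $\alpha>0$, $\alpha\ne1$, is $$S_\alpha(\boldsymbol V)=\frac{1}{1-\alpha}\left(\prod_{i=1}^n\int_0^\infty h_i^\alpha(x)\,dx-1\right).$$ *)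

(* Defs.v *)
From HB Require Import structures.
From mathcomp Require Import all_boot all_order all_algebra.
From mathcomp Require Import all_classical all_reals all_analysis.
From mathcomp Require Import measurable_realfun.

Set Implicit Arguments.
Unset Strict Implicit.
Unset Printing Implicit Defensive.

Import Order.TTheory GRing.Theory Num.Theory.
Import numFieldNormedType.Exports.

Local Open Scope classical_set_scope.
Local Open Scope ring_scope.

Section independence.
Context d (T : measurableType d) (R : realType) (P : probability T R).

Definition independent_rv d1 d2 (T1 : measurableType d1)
    (T2 : measurableType d2) (X : T -> T1) (Y : T -> T2) : Prop :=
  forall (A : set T1) (B : set T2), measurable A -> measurable B ->
    P (X @^-1` A `&` Y @^-1` B) = (P (X @^-1` A) * P (Y @^-1` B))%E.

Definition mutually_independent (I : finType) d1 (T1 : measurableType d1)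
    (X : I -> T -> T1) : Prop :=
  forall (J : {set I}) (A : I -> set T1), (forall i, measurable (A i)) ->
    P (\bigcap_(i in [set` J]) X i @^-1` A i) =
    (\prod_(i in J) P (X i @^-1` A i))%E.

End independence.

Section densities.
Context d (T : measurableType d) (R : realType) (P : probability T R).

Definition has_pdf (X : {RV P >-> R}) (f : R -> R) : Prop :=
  [/\ measurable_fun [set: R] f,
      forall x, 0 <= f x &
      forall A : set R, measurable A ->
        distribution P X A = (\int[lebesgue_measure]_(x in A) (f x)%:E)%E].

(* A choice of density, unique up to Lebesgue-null sets; the zero function if
   the law of X is not absolutely continuous. *)
Definition pdf (X : {RV P >-> R}) : R -> R :=
  xget (cst 0) [set h | has_pdf X h].

(* Extended-real valued, since the integrals may diverge. *)
Definition tsallis_entropy (n : nat) (alpha : R) (V : 'I_n -> {RV P >-> R}) :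
    \bar R :=
  (((1 - alpha)^-1)%:E *
   ((\prod_(i < n)
      (\int[lebesgue_measure]_(x in `[0%R, +oo[) (pdf (V i) x `^ alpha)%:E))
    - 1))%E.

End densities.

(* [powR] satisfies 0 `^ 0 = 1 and 0 `^ t = 0 for t > 0, so this is concavity
   of log f with the convention log 0 = -oo. *)
Definition log_concave (R : realType) (f : R -> R) : Prop :=
  (forall x, 0 <= f x) /\
  forall x y t : R, 0 <= t <= 1 ->
    f x `^ t * f y `^ (1 - t) <= f (t * x + (1 - t) * y).

Section mrssu.
Context d (T : measurableType d) d' (T' : measurableType d') (R : realType).
Variables (P : probability T R) (P' : probability T' R).

Definition simple_random_sample (X : {RV P >-> R}) (m : nat)
    (S : 'I_m -> {RV P' >-> R}) : Prop :=
  mutually_independent P' (fun j => S j : T' -> R) /\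
  forall (j : 'I_m) (A : set R), measurable A ->
    distribution P' (S j) A = distribution P X A.

(* Indices start at 0: component i is the maximum of a sample of size i.+1. *)
Definition is_MRSSU (X : {RV P >-> R}) (n : nat)
    (V : 'I_n -> {RV P' >-> R}) : Prop :=
  mutually_independent P' (fun i => V i : T' -> R) /\
  forall i : 'I_n, exists S : 'I_i.+1 -> {RV P' >-> R},
    simple_random_sample X S /\
    forall w, V i w = \big[Num.max/S ord0 w]_(j < i.+1) S j w.

End mrssu.

Definition random_vector (T : Type) (R : Type) (n : nat) (V : 'I_n -> T -> R) :
  T -> n.-tuple R := fun w => [tuple V i w | i < n].

(* Main.v *)
(** If [V] has density [h] and [W] is independent of [V] with law [G], then
    [V + W] has density [k x = \int h (x - y) dG(y)], an average of translates
    of [h]. Jensen's inequality for [u |-> u^alpha], Tonelli and translation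
    invariance give [\int k^alpha <= \int h^alpha] for [alpha > 1], and the
    reverse inequality for [alpha < 1]; in both cases the Tsallis entropy of
    [V + W] dominates that of [V]. A maximum of finitely many copies of [X]
    avoids every null set that [X] avoids, so the components of the two vectors
    have densities and are almost surely non-negative. *)

Require Import Defs.
From HB Require Import structures.
From mathcomp Require Import all_boot all_order all_algebra.
From mathcomp Require Import all_classical all_reals all_analysis.
From mathcomp Require Import measurable_realfun.
Import Order.TTheory GRing.Theory Num.Theory.
Import numFieldNormedType.Exports.
Local Open Scope classical_set_scope.
Local Open Scope ring_scope.

Set Implicit Arguments.
Unset Strict Implicit.

(** Hölder's inequality for [g] and the constant 1, whose norm is 1 because [Q] has total mass 1.
    The case [p = 1] is settled separately, since the conjugate exponent [(1 - p^-1)^-1] degenerates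
    there. *)
Lemma jensen_powR d (T : measurableType d) (R : realType)
    (Q : probability T R) (g : T -> R) (p : R) :
  measurable_fun [set: T] g -> (forall x, 0 <= g x) -> 1 <= p ->
  ((\int[Q]_x (g x)%:E) `^ p <= \int[Q]_x (g x `^ p)%:E)%E.
Proof.
move=> mg g0; rewrite le_eqVlt => /predU1P[<-|p1].
  rewrite poweRe1; last by apply: integral_ge0 => x _; rewrite lee_fin.
  by under [leRHS]eq_integral do rewrite powRr1//.
have p0 : 0 < p by exact: lt_trans p1.
have q0 : 0 < (1 - p^-1)^-1 by rewrite invr_gt0 subr_gt0 invf_lt1.
have := @hoelder _ _ _ Q g (cst 1) p _ mg (@measurable_cst _ _ _ _ _ (1 : R)) p0 q0.
rewrite invrK addrC subrK => /(_ erefl).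
rewrite Lnorm_cst1 [X in (_ * X)%E](_ : _ = 1%E); last first.
  exact: etrans (congr1 (poweR^~ _) (probability_setT Q)) (poweR1r _).
rewrite mule1 Lnorm1 => h.
have {}h : (\int[Q]_x (g x)%:E <= Lnorm Q p%:E (EFin \o g))%E.
  apply: le_trans h; rewrite le_eqVlt; apply/orP; left; apply/eqP.
  by apply: eq_integral => x _; rewrite /= mulr1 ger0_norm.
apply: (@le_trans _ _ ((Lnorm Q p%:E (EFin \o g)) `^ p)%E).
  apply: gt0_ler_poweR => //; rewrite ?ltW//.
    by rewrite in_itv/= leey andbT integral_ge0// => x _; rewrite lee_fin.
  by rewrite in_itv/= leey andbT Lnorm_ge0.
rewrite (poweR_Lnorm _ _ (lt0r_neq0 p0)) le_eqVlt; apply/orP; left; apply/eqP.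
by apply: eq_integral => x _ /=; rewrite ger0_norm.
Qed.

(** * Translation invariance of Lebesgue measure and integral *)

Section translation.
Context (R : realType).
Local Notation mu := (@lebesgue_measure R).

Lemma lebesgue_measure_translation (c : R) (A : set R) : measurable A ->
  mu ((fun x => x - c) @^-1` A) = mu A.
Proof.
have mc : measurable_fun [set: R] (fun x : R => x - c).
  exact: measurable_funB.
move=> mA; apply/esym.
(* Lebesgue measure is determined by its values on the intervals []a, b]], and the shift sends these
   to intervals of the same length. *)
apply: (@lebesgue_measure_unique R
  (pushforward mu (fun x : measurableTypeR R => x - c : measurableTypeR R))) => //.
move=> _ [[a b]] _ <-.
rewrite /pushforward [X in _ = mu X](_ : _ = `]a + c, b + c]%classic); last first.
  by apply/seteqP; split => x /=; rewrite !in_itv/= ltrBrDr lerBlDr.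
rewrite !lebesgue_measure_itv/= !lte_fin ltrD2r.
by case: ifP => // _; rewrite -!EFinB opprD addrACA subrr addr0.
Qed.

Lemma ge0_integral_translation (c : R) (f : R -> \bar R) :
  measurable_fun [set: R] f -> (forall x, 0 <= f x)%E ->
  (\int[mu]_x f (x - c)%R = \int[mu]_x f x)%E.
Proof.
move=> mf f0.
have mc : measurable_fun [set: measurableTypeR R]
    (fun x : measurableTypeR R => x - c : measurableTypeR R).
  exact: measurable_funB.
rewrite -(@ge0_integral_pushforward _ _ _ _ R _ mc mu setT f)//.
by apply: eq_measure_integral => A mA _; exact: lebesgue_measure_translation.
Qed.

End translation.

Lemma pdfP d (T : measurableType d) (R : realType) (P : probability T R)
  (X : {RV P >-> R}) (f : R -> R) : has_pdf X f -> has_pdf X (pdf X).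
Proof.
move=> Xf.
exact: (@xgetPex _ (cst 0) [set h | has_pdf X h] (ex_intro _ f Xf)).
Qed.

(** Radon-Nikodym: the derivative is finite everywhere, so [fine] makes it real-valued without
    changing its integrals. *)
Lemma dominates_has_pdf d (T : measurableType d) (R : realType)
    (P : probability T R) (X : {RV P >-> R}) :
  distribution P X `<< @lebesgue_measure R -> exists f, has_pdf X f.
Proof.
move=> Xmu.
(* [R] and the carrier of [lebesgue_measure] have the same measurable sets but
   different displays, so the law of [X] is rebuilt over the latter. *)
have mX : measurable_fun [set: T] (X : T -> measurableTypeR R).
  exact: (@measurable_funPT _ _ _ _ X).
pose XR : {RV P >-> measurableTypeR R} :=
  HB.pack (X : T -> measurableTypeR R)
    (@isMeasurableFun.Build _ _ T (measurableTypeR R) X mX).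
have [f [f0 ffin fint fE]] :=
  @radon_nikodym_sigma_finite _ _ _ (@lebesgue_measure R) (distribution P XR) Xmu.
exists (fine \o f); split.
- have /integrableP[mf _] := fint.
  exact: measurableT_comp.
- by move=> x; exact: fine_ge0.
- by move=> A mA; rewrite fE//; apply: eq_integral => x _; rewrite fineK.
Qed.

(** * The law and the density of a sum as convolutions *)

Section sum.
Context d (T : measurableType d) (R : realType) (P : probability T R).
Variables (V W Z : {RV P >-> R}).
Hypothesis indVW : independent_rv P V W.
Hypothesis ZE : forall w, Z w = V w + W w.
Local Notation mu := (@lebesgue_measure R).

Lemma distribution_sum (A : set R) : measurable A ->
  distribution P Z A =
  (\int[distribution P W]_y distribution P V ((fun v => v + y)%R @^-1` A))%E.
Proof.
move=> mA.
have madd : measurable_fun [set: R * R] (fun p : R * R => p.2 + p.1).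
  by apply: measurable_funD.
have mB : measurable ((fun p : R * R => p.2 + p.1) @^-1` A).
  by rewrite -[X in measurable X]setTI; exact: madd.
have mpair : measurable_fun [set: T] (fun w => (W w, V w)).
  exact: measurable_fun_pair.
(* By independence the joint law of [(W, V)] is the product measure, whose value on a set is the
   integral of the measures of its sections. Taking [W] first makes the outer integral run over the
   law of [W]. *)
transitivity ((distribution P W \x distribution P V)%E
   ((fun p : R * R => p.2 + p.1) @^-1` A)).
  rewrite (@product_measure_unique _ _ _ _ _ (distribution P W)
    (distribution P V) (pushforward P (fun w => (W w, V w))))//.
    rewrite /distribution /pushforward/=; congr (P _).
    by apply/seteqP; split=> w /=; rewrite ZE.
  move=> B C mB' mC; rewrite /pushforward/=.
  have := indVW mC mB'; rewrite muleC => <-; congr (P _).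
  by apply/seteqP; split=> w /= [].
apply: eq_integral => y _ /=; congr (distribution P V _).
by apply/seteqP; split=> v; rewrite /xsection/= inE.
Qed.

End sum.

Section convolution.
Context d (T : measurableType d) (R : realType) (P : probability T R).
Variables (V W Z : {RV P >-> R}) (h k : R -> R).
Hypothesis indVW : independent_rv P V W.
Hypothesis ZE : forall w, Z w = V w + W w.
Hypotheses (hV : has_pdf V h) (kZ : has_pdf Z k).
Local Notation mu := (@lebesgue_measure R).
Local Notation nu := (distribution P W).

Let measurable_sub_pdf :
  measurable_fun [set: measurableTypeR R * R] (fun p : R * R => h (p.1 - p.2)).
Proof.
have [mh _ _] := hV.
apply: (measurableT_comp mh).
exact: (measurable_funB (@measurable_fst _ _ (measurableTypeR R) R)
  (@measurable_snd _ _ (measurableTypeR R) R)).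
Qed.

(** Both sides have the same integral over every measurable set, and [k] is integrable with total
    mass 1; this determines [k] almost everywhere. *)
Lemma pdf_sum :
  ae_eq mu [set: R] (EFin \o k) (fun x => \int[nu]_y (h (x - y))%:E)%E.
Proof.
have [mh h0 hE] := hV; have [mk k0 kE] := kZ.
have mEh : measurable_fun [set: R] (fun x => (h x)%:E) by exact/measurable_EFinP.
apply: integral_ae_eq => //.
- apply/integrableP; split; first exact/measurable_EFinP.
  under eq_integral => x _ do rewrite /= ger0_norm//.
  by rewrite -kE// probability_setT ltry.
- apply: (@measurable_fun_fubini_tonelli_F _ _ (measurableTypeR R) R R nu
    (fun p => (h (p.1 - p.2))%:E)).
  + exact/measurable_EFinP.
  + by move=> x; rewrite lee_fin.
move=> A _ mA; rewrite -kE// (distribution_sum indVW ZE mA).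
(* Moving the constraint into the integrand as an indicator gives a function on the whole product,
   to which Tonelli applies. *)
pose f (p : R * R) : \bar R := (h (p.1 - p.2) * \1_A p.1)%:E.
transitivity (\int[nu]_y \int[mu]_x f (x, y))%E.
  apply: eq_integral => y _.
  have my : measurable ((fun v : R => v + y) @^-1` A).
    by rewrite -[X in measurable X]setTI; apply: measurable_funD.
  rewrite hE// integral_mkcond.
  (* The substitution [v = x - y] turns the condition on [v + y] into [x \in A]. *)
  rewrite -(@ge0_integral_translation R y
    ((fun v => (h v)%:E) \_ ((fun v => v + y) @^-1` A))); last 2 first.
  - by apply: (measurable_restrictT _ my).1; exact: measurable_funTS.
  - by move=> x; apply: erestrict_ge0 => ? _; rewrite lee_fin.
  apply: eq_integral => x _.
  rewrite /f patchE/= indicE.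
  have -> : (x - y \in (fun v : R => v + y) @^-1` A) = (x \in A).
    by apply/idP/idP; rewrite !inE/= subrK.
  by case: ifP; rewrite ?mulr1 ?mulr0.
rewrite -(@fubini_tonelli _ _ _ _ R mu nu f); last 2 first.
- apply/measurable_EFinP; apply: measurable_funM => //.
  apply: measurableT_comp => //.
- by move=> x; rewrite lee_fin mulr_ge0.
rewrite [RHS]integral_mkcond; apply: eq_integral => x _.
rewrite patchE /f/= indicE; case: ifP => _.
  by under eq_integral do rewrite mulr1.
by under eq_integral do rewrite mulr0; rewrite integral0.
Qed.

(** After Tonelli the inner integral over [x] does not depend on [y], and [nu] has mass 1. *)
Lemma integral_sub_pdf_powR (a : R) :
  (\int[mu]_x \int[nu]_y (h (x - y) `^ a)%:E =
   \int[mu]_x (h x `^ a)%:E)%E.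
Proof.
have [mh h0 hE] := hV.
have mha : measurable_fun [set: R] (fun x => h x `^ a).
  exact: (@measurableT_comp _ _ _ _ _ _ (@powR R ^~ a)).
rewrite (@fubini_tonelli _ _ _ _ R mu nu
    (fun p : R * R => (h (p.1 - p.2) `^ a)%:E)) /=; last 2 first.
- apply/measurable_EFinP.
  exact: (@measurableT_comp _ _ _ _ _ _ (@powR R ^~ a)).
- by move=> x; rewrite lee_fin powR_ge0.
under eq_integral => y _.
  rewrite (@ge0_integral_translation R y (fun x => (h x `^ a)%:E)); last 2 first.
  - exact/measurable_EFinP.
  - by move=> x; rewrite lee_fin powR_ge0.
  over.
by rewrite integral_cst//= probability_setT mule1.
Qed.

End convolution.

Lemma measurable_powR_pdf d (T : measurableType d) (R : realType)
    (P : probability T R) (V : {RV P >-> R}) (f : R -> R) (a : R) :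
  has_pdf V f -> measurable_fun [set: R] (fun x => (f x `^ a)%:E).
Proof.
move=> [mf _ _]; apply/measurable_EFinP.
exact: (@measurableT_comp _ _ _ _ _ _ (@powR R ^~ a)).
Qed.

(** * Integrals of powers of the density before and after convolution *)

Section powR_pdf_sum.
Context d (T : measurableType d) (R : realType) (P : probability T R).
Variables (V W Z : {RV P >-> R}) (h k : R -> R) (a : R).
Hypothesis indVW : independent_rv P V W.
Hypothesis ZE : forall w, Z w = V w + W w.
Hypotheses (hV : has_pdf V h) (kZ : has_pdf Z k).
Local Notation mu := (@lebesgue_measure R).
Local Notation nu := (distribution P W).

Let mh : measurable_fun [set: R] h. Proof. by case: hV. Qed.
Let h0 x : 0 <= h x. Proof. by case: hV. Qed.

Let mhx x : measurable_fun [set: R] (fun y => h (x - y)).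
Proof. by apply: (measurableT_comp mh); apply: measurable_funB. Qed.

Let measurable_convolution_powR :
  measurable_fun [set: R] (fun x => \int[nu]_y (h (x - y) `^ a)%:E)%E.
Proof.
apply: (@measurable_fun_fubini_tonelli_F _ _ R R R nu
    (fun p => (h (p.1 - p.2) `^ a)%:E)).
- apply/measurable_EFinP.
  apply: (@measurableT_comp _ _ _ _ _ _ (@powR R ^~ a)) => //.
  by apply: (measurableT_comp mh); exact: measurable_funB.
- by move=> x; rewrite lee_fin powR_ge0.
Qed.

Lemma integral_powR_pdf_sum_le : 1 <= a ->
  (\int[mu]_x (k x `^ a)%:E <= \int[mu]_x (h x `^ a)%:E)%E.
Proof.
move=> a1; rewrite -(integral_sub_pdf_powR W hV).
apply: ae_ge0_le_integral => //.
- by move=> x _; rewrite lee_fin powR_ge0.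
- exact: measurable_powR_pdf kZ.
- by move=> x _; apply: integral_ge0 => y _; rewrite lee_fin powR_ge0.
apply: filterS (pdf_sum indVW ZE hV kZ) => x /(_ I) /= kx _.
by rewrite -poweR_EFin kx; exact: jensen_powR.
Qed.

Lemma integral_powR_pdf_sum_ge : 0 < a -> a <= 1 ->
  (\int[mu]_x (h x `^ a)%:E <= \int[mu]_x (k x `^ a)%:E)%E.
Proof.
move=> a0 a1; rewrite -(integral_sub_pdf_powR W hV).
apply: ae_ge0_le_integral => //.
- by move=> x _; apply: integral_ge0 => y _; rewrite lee_fin powR_ge0.
- by move=> x _; rewrite lee_fin powR_ge0.
- exact: measurable_powR_pdf kZ.
apply: filterS (pdf_sum indVW ZE hV kZ) => x /(_ I) /= kx _.
rewrite -poweR_EFin kx.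
have := @jensen_powR _ _ _ nu (fun y => h (x - y) `^ a) a^-1.
under [X in _ -> _ -> _ -> (_ <= X)%E]eq_integral do
  rewrite -powRrM divff ?gt_eqF// powRr1//.
rewrite invf_ge1// => /(_ _ _ a1) hle.
set I := (\int[nu]_y (h (x - y) `^ a)%:E)%E.
have I0 : (0 <= I)%E by apply: integral_ge0 => y _; rewrite lee_fin powR_ge0.
(* Writing [I] as the [a]-th power of its [a^-1]-th power reduces the goal to [hle] by
   monotonicity. *)
rewrite -[leLHS](poweRe1 I0) -(mulVf (lt0r_neq0 a0)) poweRrM.
apply: gt0_ler_poweR; rewrite ?(ltW a0)// ?in_itv/= ?leey ?andbT ?poweR_ge0//.
  by apply: integral_ge0 => y _; rewrite lee_fin.
apply: hle => [|y]; last exact: powR_ge0.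
exact: (@measurableT_comp _ _ _ _ _ _ (@powR R ^~ a)).
Qed.

End powR_pdf_sum.

Section halfline.
Context d (T : measurableType d) (R : realType) (P : probability T R).
Variables (V : {RV P >-> R}) (f : R -> R) (a : R).
Hypotheses (Vf : has_pdf V f) (V0 : {ae P, forall w, 0 <= V w}) (a0 : 0 < a).
Local Notation mu := (@lebesgue_measure R).

(** The density integrates to the probability of [V < 0], which is 0, over the negative half-line,
    so it vanishes almost everywhere there. So does its power, because [a > 0] excludes the
    convention that 0 to the power 0 is 1. *)
Lemma integral_powR_pdf_halfline :
  (\int[mu]_(x in `[0%R, +oo[) (f x `^ a)%:E = \int[mu]_x (f x `^ a)%:E)%E.
Proof.
have [mf f0 fE] := Vf.
have f_eq0 : ae_eq mu `]-oo, 0%R[%classic (EFin \o f) (cst 0%E).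
  apply/ae_eq_integral_abs => //.
    by apply: measurable_funTS; exact/measurable_EFinP.
  under eq_integral => x _ do rewrite /= ger0_norm//.
  rewrite -fE//; apply/eqP; rewrite -measure_le0.
  have [N [mN PN VN]] := V0.
  rewrite -PN; apply: (@le_measure _ _ _ P (V @^-1` `]-oo, 0%R[) N); rewrite ?inE//.
    by apply: measurable_funPTI; exact: measurable_itv.
  by move=> w /=; rewrite in_itv/= => Vw; apply: VN => /=; rewrite leNgt Vw.
rewrite -[in RHS](setUv `]-oo, (0 : R)[) setCitvl ge0_integral_setU//=; last 3 first.
- by apply: measurable_funTS; exact: measurable_powR_pdf Vf.
- by move=> x _; rewrite lee_fin powR_ge0.
- by rewrite disj_set2E -setCitvl setICr eqxx.
rewrite [X in (X + _)%E](_ : _ = 0%E) ?add0e//.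
rewrite (ae_eq_integral (cst 0%E)) ?integral0//.
- by apply: measurable_funTS; exact: measurable_powR_pdf Vf.
- by apply: filterS f_eq0 => x fx Dx; have /= [->] := fx Dx; rewrite powR0// gt_eqF.
Qed.

End halfline.

Lemma has_pdf_dominates d (T : measurableType d) (R : realType)
    (P : probability T R) (X : {RV P >-> R}) (f : R -> R) :
  has_pdf X f -> distribution P X `<< @lebesgue_measure R.
Proof.
move=> [mf f0 fE]; apply/null_content_dominatesP => A mA A0.
by rewrite fE// null_set_integral//; apply: measurable_funTS; exact/measurable_EFinP.
Qed.

(** Translates of a null set are null, so the integrand in [distribution_sum] vanishes for every
    [y]. This ensures that [pdf Z] is a true density and not the default zero function. *)
Lemma has_pdf_sum d (T : measurableType d) (R : realType)
    (P : probability T R) (V W Z : {RV P >-> R}) (h : R -> R) :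
  independent_rv P V W -> (forall w, Z w = V w + W w) -> has_pdf V h ->
  has_pdf Z (pdf Z).
Proof.
move=> VW ZE Vh; suff [k Zk] : exists k, has_pdf Z k by exact: pdfP Zk.
apply: dominates_has_pdf; apply/null_content_dominatesP => A mA A0.
have /null_content_dominatesP domV := has_pdf_dominates Vh.
rewrite (distribution_sum VW ZE mA).
apply: integral0_eq => y _.
have -> : (fun v : R => v + y) = (fun v => v - - y).
  by apply/funext => v; rewrite opprK.
apply: domV.
  by rewrite -[X in measurable X]setTI; apply: measurable_funB.
exact: etrans (lebesgue_measure_translation (- y) mA) A0.
Qed.

(** * Null sets, densities and signs of the components of the sampled vectors *)

Section MRSSU.
Context d (T : measurableType d) d' (T' : measurableType d') (R : realType).
Context (P : probability T R) (P' : probability T' R).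
Variables (X : {RV P >-> R}) (n : nat) (V : 'I_n -> {RV P' >-> R}).
Hypothesis XV : is_MRSSU X V.

(** A maximum is one of the sampled values, so it lies in [A] only if some [S j] does: a finite
    union of null events. Applied to Lebesgue-null sets it yields densities, and to the negative
    half-line it yields non-negativity. *)
Lemma MRSSU_null (i : 'I_n) (A : set R) : measurable A ->
  distribution P X A = 0%E -> distribution P' (V i) A = 0%E.
Proof.
move=> mA XA0; have [_ /(_ i)[S [[_ SX] VE]]] := XV.
have mpre (Z : {RV P' >-> R}) : measurable (Z @^-1` A).
  exact: measurable_funPTI.
suff : P'.-negligible (V i @^-1` A) by move/(negligibleP _ (mpre _)).
have aeS : {ae P', forall w, forall j, ~ A (S j w)}.
  apply: filter_forall => j; apply: (@negligibleS _ _ _ _ (S j @^-1` A)).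
    by move=> w /= /contrapT.
  by apply/(negligibleP _ (mpre _)); rewrite -XA0; exact: SX.
apply: negligibleS aeS => w /= Aw /= AS; move: Aw.
(* The default value of the iterated maximum is [S ord0 w], itself a sampled value, so it too avoids
   [A]. *)
rewrite /= VE; elim/big_ind: _ => [|x y Ax Ay|j _]; [exact: AS| |exact: AS].
by rewrite /Num.max; case: ifP.
Qed.

Lemma MRSSU_has_pdf (f : R -> R) (i : 'I_n) :
  has_pdf X f -> has_pdf (V i) (pdf (V i)).
Proof.
move=> Xf; suff [g Vg] : exists g, has_pdf (V i) g by exact: pdfP Vg.
apply: dominates_has_pdf; apply/null_content_dominatesP => A mA A0.
have /null_content_dominatesP domX := has_pdf_dominates Xf.
by apply: MRSSU_null => //; exact: domX.
Qed.

Lemma MRSSU_ge0 (i : 'I_n) :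
  {ae P, forall w, 0 <= X w} -> {ae P', forall w, 0 <= V i w}.
Proof.
have mpre d0 (T0 : measurableType d0) (P0 : probability T0 R)
    (Z : {RV P0 >-> R}) : measurable (Z @^-1` `]-oo, 0%R[).
  by apply: measurable_funPTI; exact: measurable_itv.
have preE d0 (T0 : measurableType d0) (Z : T0 -> R) :
    Z @^-1` `]-oo, 0%R[ = ~` [set w | 0 <= Z w].
  by apply/seteqP; split=> w; rewrite /= in_itv/= ltNge => /negP.
move=> X0; suff : distribution P' (V i) `]-oo, 0%R[ = 0%E.
  by rewrite /distribution/= => /(negligibleP _ (mpre _ _ _ _)); rewrite preE.
apply: MRSSU_null; first exact: measurable_itv.
by apply/(negligibleP _ (mpre _ _ _ _)); rewrite preE.
Qed.

End MRSSU.

(** * From integrals of powers to entropies *)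

Lemma tsallis_entropy_le d (T : measurableType d) (R : realType)
    (P : probability T R) (n : nat) (alpha : R) (V W : 'I_n -> {RV P >-> R}) :
  (let I (Z : {RV P >-> R}) :=
     \int[lebesgue_measure]_(x in `[0%R, +oo[) (pdf Z x `^ alpha)%:E in
   forall i, if (1 < alpha)%R then I (W i) <= I (V i) else I (V i) <= I (W i))%E ->
  (tsallis_entropy alpha V <= tsallis_entropy alpha W)%E.
Proof.
set I := (fun Z => \int[_]_(x in _) _)%E => /= IVW; rewrite /tsallis_entropy.
have prod_le (F G : 'I_n -> \bar R) : (forall i, 0 <= F i <= G i)%E ->
    (\prod_(i < n) F i <= \prod_(i < n) G i)%E.
  move=> FG.
  (* Non-negativity is carried through the induction because the factors, possibly infinite, can be
     multiplied monotonically only when they are non-negative. *)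
  suff /andP[] : (0 <= \prod_(i < n) F i <= \prod_(i < n) G i)%E by [].
  elim/big_ind2 : _ => [|x1 x2 y1 y2 /andP[x10 x12] /andP[y10 y12]|//].
    by rewrite lee01 lexx.
  by rewrite mule_ge0//= lee_pmul.
have I0 Z : (0 <= I Z)%E by apply: integral_ge0 => x _; rewrite lee_fin powR_ge0.
case: ltP IVW => alpha1 IVW.
  (* For [alpha > 1] the coefficient is negative; factoring out the sign reverses the comparison of
     the products. *)
  have aN : (1 - alpha)^-1 = - (alpha - 1)^-1 by rewrite -invrN opprB.
  have c0 : (0 <= ((alpha - 1)^-1)%:E)%E by rewrite lee_fin invr_ge0 subr_ge0 ltW.
  rewrite aN EFinN.
  rewrite [leLHS]mulNe [leRHS]mulNe leeN2.
  apply: lee_wpmul2l; first exact: c0.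
  by apply: leeD2r; apply: prod_le => i; rewrite I0 IVW.
have c0 : (0 <= ((1 - alpha)^-1)%:E)%E by rewrite lee_fin invr_ge0 subr_ge0.
apply: lee_wpmul2l; first exact: c0.
by apply: leeD2r; apply: prod_le => i; rewrite I0 IVW.
Qed.

Lemma tsallis_entropy_sum_ge d (T : measurableType d) (R : realType)
    (P : probability T R) (n : nat) (alpha : R) (V W Z : 'I_n -> {RV P >-> R}) :
  0 < alpha ->
  (forall i, independent_rv P (V i) (W i)) ->
  (forall i w, Z i w = V i w + W i w) ->
  (forall i, has_pdf (V i) (pdf (V i))) ->
  (forall i, {ae P, forall w, 0 <= V i w}) ->
  (forall i, {ae P, forall w, 0 <= W i w}) ->
  (tsallis_entropy alpha V <= tsallis_entropy alpha Z)%E.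
Proof.
move=> a0 VW ZE Vpdf V0 W0; apply: tsallis_entropy_le => I i.
have Zpdf : has_pdf (Z i) (pdf (Z i)).
  exact: (has_pdf_sum (VW i) (ZE i) (Vpdf i)).
have Z0 : {ae P, forall w, 0 <= Z i w}.
  by apply: filterS2 (V0 i) (W0 i) => w Vw Ww; rewrite ZE addr_ge0.
(* The entropies integrate over the half-line, the convolution bounds over the whole line;
   non-negativity of [V i] and [Z i] identifies the two. *)
rewrite /I (integral_powR_pdf_halfline (Vpdf i) (V0 i) a0).
rewrite (integral_powR_pdf_halfline Zpdf Z0 a0); case: ifPn => alpha1.
  exact: (integral_powR_pdf_sum_le (VW i) (ZE i) (Vpdf i) Zpdf (ltW alpha1)).
rewrite -leNgt in alpha1.
exact: (integral_powR_pdf_sum_ge (VW i) (ZE i) (Vpdf i) Zpdf a0 alpha1).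
Qed.

(** An event on one coordinate is the preimage of a measurable set of tuples under the
    projection. *)
Lemma independent_rv_coordinate d (T : measurableType d) (R : realType)
    (P : probability T R) (n : nat) (V W : 'I_n -> T -> R) (i : 'I_n) :
  independent_rv P (random_vector V) (random_vector W) ->
  independent_rv P (V i) (W i).
Proof.
move=> VW A B mA mB.
have pre (Z : 'I_n -> T -> R) (C : set R) :
    Z i @^-1` C = random_vector Z @^-1` ((fun t => tnth t i) @^-1` C).
  by apply/seteqP; split=> w; rewrite /random_vector/= tnth_mktuple.
have mpre (C : set R) : measurable C ->
    measurable ((fun t : n.-tuple R => tnth t i) @^-1` C).
  by move=> mC; rewrite -[X in measurable X]setTI; exact: measurable_tnth.
by rewrite !pre; apply: VW; exact: mpre.
Qed.

Lemma independent_rvC d (T : measurableType d) (R : realType)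
    (P : probability T R) d1 d2 (T1 : measurableType d1)
    (T2 : measurableType d2) (X : T -> T1) (Y : T -> T2) :
  independent_rv P X Y -> independent_rv P Y X.
Proof. by move=> XY A B mA mB; rewrite setIC muleC; exact: XY. Qed.

Unset Implicit Arguments.

Theorem theorem2p7 (R : realType)
  (d : measure_display) (T : measurableType d) (P : probability T R)
  (d' : measure_display) (T' : measurableType d') (P' : probability T' R)
  (X Y : {RV P >-> R}) (n : nat) (alpha : R)
  (XM YM : 'I_n -> {RV P' >-> R})
  (hX0 : {ae P, forall w, 0 <= X w}) (hY0 : {ae P, forall w, 0 <= Y w})
  (hXY : independent_rv P X Y)
  (hn : (0 < n)%N) (ha0 : 0 < alpha) (ha1 : alpha != 1)
  (hX : exists f : R -> R, has_pdf X f /\ log_concave f)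
  (hY : exists g : R -> R, has_pdf Y g /\ log_concave g)
  (hXM : is_MRSSU X XM) (hYM : is_MRSSU Y YM)
  (hXMYM : independent_rv P' (random_vector (fun i => XM i : T' -> R))
                             (random_vector (fun i => YM i : T' -> R))) :
  (Order.max (tsallis_entropy alpha XM) (tsallis_entropy alpha YM)
   <= tsallis_entropy alpha (fun i => (XM i \+ YM i)%R : {RV P' >-> R}))%E.
Proof.
have [f [Xf _]] := hX; have [g [Yg _]] := hY.
have XMpdf i := MRSSU_has_pdf hXM i Xf.
have YMpdf i := MRSSU_has_pdf hYM i Yg.
have XM0 i := MRSSU_ge0 hXM i hX0.
have YM0 i := MRSSU_ge0 hYM i hY0.
have ind i := independent_rv_coordinate i hXMYM.
rewrite ge_max; apply/andP; split.
  exact: tsallis_entropy_sum_ge ha0 ind _ XMpdf XM0 YM0.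
(* The second bound is the first with the two vectors exchanged, by symmetry of independence and
   commutativity of addition. *)
apply: (tsallis_entropy_sum_ge ha0 (fun i => independent_rvC (ind i)) _ YMpdf YM0 XM0).
by move=> i w /=; rewrite addrC.
Qed.
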